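(* Let $\mathcal{F}$ be a finite family of convex sets in $\mathbb{R}^d$. (i) For each fixed integer $k\ge 2$ there is a constant $c_k>0$ such that: if $\mathcal{F}$ is $k$-intersecting, then there exists a point $p$ such that every hyperplane through $p$ intersects at least $c_k\frac{|\mathcal{F}|}{\sqrt[k]{d+1}}$ sets of $\mathcal{F}$ (i.e. $\Omega\big(|\mathcal{F}|/\sqrt[k]{d+1}\big)$ sets). (ii) If $\mathcal{F}$ is $d$-intersecting, then there exists a point $p$ such that every hyperplane through $p$ intersects at least $\frac{d}{d+1}|\mathcal{F}|$ sets of $\mathcal{F}$. (iii) If $\mathcal{F}$ is $\lceil d/2\rceil$-intersecting, then there exists a point $p$ such that every hyperplane through $p$ intersects at least $\frac{1}{\sqrt[d]{225}}|\mathcal{F}|$ sets of $\mathcal{F}$.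
   Context: A family is $k$-intersecting if every subfamily of at most $k$ of its members has nonempty intersection. A hyperplane is transversal to a set if it intersects it.
   Formalization: Part (ii) is stated for d ≥ 2 and part (iii) for ⌈d/2⌉ ≥ 2 (d ≥ 3): for d = 1 in (ii) and d = 1, 2 in (iii) the family need only have nonempty members, and finitely many distinct points (3, 226, 31) refute the claim. *)

(* Defs.v *)
From mathcomp Require Import all_boot all_order all_algebra.
From mathcomp Require Import boolp classical_sets reals exp convex.

Set Implicit Arguments.
Unset Strict Implicit.
Unset Printing Implicit Defensive.

Import Order.TTheory GRing.Theory Num.Theory.

Local Open Scope classical_set_scope.
Local Open Scope ring_scope.

(* A finite family is indexed by a finType and may repeat a set; members are
   counted with multiplicity.  A family of pairwise distinct sets is the case
   of an injective F. *)
Definition k_intersecting (T : Type) (I : finType) (k : nat) (F : I -> set T)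
    : Prop :=
  forall J : {set I}, (#|J| <= k)%N -> \bigcap_(i in [set` J]) F i !=set0.

Definition hyperplane (R : realType) (d : nat) (H : set 'rV[R]_d) : Prop :=
  exists2 a : 'cV[R]_d, a != 0 &
    exists b : R, H = [set x | (x *m a) ord0 ord0 = b].

Definition transversal (T : Type) (H A : set T) : Prop := H `&` A !=set0.

Definition num_transversal (T : Type) (I : finType) (H : set T)
    (F : I -> set T) : nat :=
  #|[pred i | `[< transversal H (F i) >] ]|.

(* Main.v *)
(* Call a set A of indices large if fewer than b |I| indices lie outside A.  If
   any d + 1 large sets have a common hitting set J of at most k indices, then the
   hulls of the unions of F over the d + 1 sets share a point, namely any point of
   the intersection of F over J.  Helly's theorem gives a point p in all these
   hulls, and no hyperplane through p can miss a large subfamily.  Hitting sets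
   are found greedily: by averaging, some index fails to hit fewer than b m of m
   large sets.  This suffices for b = (d+1)^(-1/k) in (i), where the constant is
   1, for b = d/(d+1) in (ii), and for b = d/(d+5) >= 225^(-1/d) in (iii). *)

Require Import Defs.
From mathcomp Require Import all_boot all_order all_algebra.
From mathcomp Require Import boolp classical_sets reals exp convex.
From mathcomp Require Import sequences interval_inference ring lra zify.

Set Implicit Arguments.
Unset Strict Implicit.
Unset Printing Implicit Defensive.

Import Order.TTheory GRing.Theory Num.Theory.

Local Open Scope classical_set_scope.
Local Open Scope ring_scope.

(** * Radon's and Helly's theorems *)

Section Helly.
Variable R : realType.

Lemma convex_setP (V : lmodType R) (A : set V) :
  convex_set A <-> forall (x y : V) (t : R), 0 <= t <= 1 -> A x -> A y ->
    A (t *: x + (1 - t) *: y).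
Proof.
split=> [cA x y t /andP[t0 t1] Ax Ay | cA x y t].
  by have := cA x y (Itv01 t0 t1); rewrite !inE => /(_ Ax Ay).
by rewrite !inE => Ax Ay; apply: cA => //; rewrite ge0 le1.
Qed.

Lemma convex_set_bary (V : lmodType R) (A : set V) (J : Type) (r : seq J)
    (P : pred J) (w : J -> R) (x : J -> V) : convex_set A ->
    (forall j, P j -> 0 < w j) -> (forall j, P j -> A (x j)) -> has P r ->
  A ((\sum_(j <- r | P j) w j)^-1 *: (\sum_(j <- r | P j) w j *: x j)).
Proof.
move=> /convex_setP cA w0 Ax Pr0.
suff [] : 0 < \sum_(j <- r | P j) w j /\
  A ((\sum_(j <- r | P j) w j)^-1 *: (\sum_(j <- r | P j) w j *: x j)) by [].
elim: r Pr0 => //= j r IHr.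
rewrite !big_cons; case: ifP => //= Pj _.
have wj0 := w0 _ Pj.
have [Pr|Pr] := boolP (has P r); last first.
  rewrite !big_hasC// !addr0 scalerA mulVf ?gt_eqF// scale1r.
  by split=> //; exact: Ax.
have [] := IHr Pr; set S := \sum_(j <- r | P j) w j; set Y := \sum_(j <- r | _) _.
move=> S0 AY; split; first by rewrite addr_gt0.
have t0 : w j + S != 0 by rewrite gt_eqF// addr_gt0.
have -> : (w j + S)^-1 *: (w j *: x j + Y) =
    (w j / (w j + S)) *: x j + (1 - w j / (w j + S)) *: (S^-1 *: Y).
  rewrite scalerDr !scalerA; congr (_ *: _ + _ *: _); first by rewrite mulrC.
  by field; rewrite t0 gt_eqF.
apply: cA => //; last exact: Ax.
apply/andP; split; first by rewrite divr_ge0 ?addr_ge0 // ltW.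
by rewrite ler_pdivrMr ?addr_gt0// mul1r lerDl ltW.
Qed.

(** Appending a coordinate 1 to each point gives [m] rows in dimension [d + 1 < m], so the left
    kernel is nonzero. *)
Lemma affine_dependent (d m : nat) (x : 'I_m -> 'rV[R]_d) : (d.+1 < m)%N ->
  exists l : 'I_m -> R, [/\ exists i, l i != 0, \sum_i l i = 0
    & \sum_i l i *: x i = 0].
Proof.
move=> dm; pose M : 'M[R]_(m, d + 1) := \matrix_(i < m) row_mx (x i) 1.
have : kermx M != 0.
  rewrite -mxrank_eq0 mxrank_ker -lt0n subn_gt0.
  by rewrite (leq_ltn_trans (rank_leq_col _))// addn1.
move=> /rowV0Pn[u /sub_kermxP uM u0]; exists (u 0).
have sumE : \sum_i u 0 i *: row_mx (x i) (1 : 'rV[R]_1) = 0.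
  by rewrite -[RHS]uM mulmx_sum_row; apply: eq_bigr => i _; rewrite rowK.
split.
- by have /rV0Pn[i ui] := u0; exists i.
- move/(congr1 rsubmx): sumE; rewrite linear_sum /= linear0.
  move=> /matrixP/(_ 0 0); rewrite summxE mxE => u1; rewrite -[RHS]u1.
  by apply: eq_bigr => i _; rewrite linearZ /= row_mxKr !mxE mulr1.
- move/(congr1 lsubmx): sumE; rewrite linear_sum /= linear0 => ux; rewrite -[RHS]ux.
  by apply: eq_bigr => i _; rewrite linearZ /= row_mxKl.
Qed.

(** Split an affine dependence by sign. The normalised positive and negative parts are the same
    point [z], and [C i] contains every point of the part to which [i] does not belong. *)
Lemma radon (d m : nat) (C : 'I_m -> set 'rV[R]_d) (x : 'I_m -> 'rV[R]_d) :
    (d.+1 < m)%N -> (forall i, convex_set (C i)) ->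
    (forall i j, i != j -> C i (x j)) ->
  exists z, forall i, C i z.
Proof.
move=> dm cC Cx; have [l [[i0 li0] l0 lx0]] := affine_dependent x dm.
have splitP (V : zmodType) (f : 'I_m -> V) : (forall i, l i = 0 -> f i = 0) ->
    \sum_i f i = \sum_(i | 0 < l i) f i + \sum_(i | 0 < - l i) f i.
  move=> f0; rewrite (bigID (fun i => 0 < l i)) /=; congr (_ + _).
  rewrite [RHS]big_mkcond [LHS]big_mkcond /=; apply: eq_bigr => i _.
  by rewrite oppr_gt0; case: ltgtP => // /esym/f0 ->.
have sumN : \sum_(i | 0 < - l i) - l i = \sum_(i | 0 < l i) l i.
  by rewrite sumrN; apply/eqP; rewrite eq_sym -addr_eq0 -splitP// l0.
have sumNx : \sum_(i | 0 < - l i) (- l i) *: x i = \sum_(i | 0 < l i) l i *: x i.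
  rewrite (eq_bigr (fun i => - (l i *: x i))); last by move=> i; rewrite scaleNr.
  rewrite sumrN; apply/eqP; rewrite eq_sym -addr_eq0 -splitP ?lx0//.
  by move=> i ->; rewrite scale0r.
(* Coefficients with sum 0 that are not all 0 take both signs, so neither part is empty. *)
have [ip lip] : exists i, 0 < l i.
  apply: contrapT => /forallNP ln; move: li0; apply/negP; rewrite negbK.
  rewrite -oppr_eq0; apply/eqP/(psumr_eq0P (P := predT) (F := fun i => - l i)) => //.
    by move=> i _; rewrite oppr_ge0 leNgt; exact/negP/ln.
  by rewrite sumrN l0 oppr0.
have [jn ljn] : exists i, 0 < - l i.
  apply: contrapT => /forallNP lp; move: li0; apply/negP; rewrite negbK.
  apply/eqP/(psumr_eq0P (P := predT) (F := l)) => // i _.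
  by rewrite leNgt -oppr_gt0; exact/negP/lp.
exists ((\sum_(i | 0 < l i) l i)^-1 *: (\sum_(i | 0 < l i) l i *: x i)) => i.
have [li|li] := ltP 0 (l i).
  rewrite -sumN -sumNx; apply: convex_set_bary => //.
    move=> j lj; apply: Cx; apply: contraTneq lj => <-.
    by rewrite oppr_gt0 -leNgt ltW.
  by apply/hasP; exists jn; rewrite ?mem_index_enum.
apply: convex_set_bary => //.
  by move=> j lj; apply: Cx; apply: contraTneq lj => <-; rewrite -leNgt.
by apply/hasP; exists ip; rewrite ?mem_index_enum.
Qed.

Lemma helly (d : nat) (T : finType) (C : T -> set 'rV[R]_d) (K : {set T}) :
    (forall i, convex_set (C i)) ->
    (forall L : {set T}, L \subset K -> (#|L| <= d.+1)%N ->
      \bigcap_(i in [set` L]) C i !=set0) ->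
  \bigcap_(i in [set` K]) C i !=set0.
Proof.
move=> cC; have [n] := ubnP #|K|; elim: n K => // n IHn K Kn CK.
have [Kd|Kd] := leqP #|K| d.+1; first exact: CK.
(* By induction, leaving out one member of [K] at a time yields the points for Radon. *)
have x_ex (i : 'I_#|K|) : exists x, forall j, j \in K -> j != enum_val i -> C j x.
  have [||x Cx] := IHn (K :\ enum_val i)%SET.
  - by move: Kn; rewrite (cardsD1 (enum_val i) K) enum_valP.
  - by move=> L LK; apply: CK; exact: fintype.subset_trans LK (finset.subsetDl _ _).
  by exists x => j jK ji; apply: Cx; rewrite /= !inE ji.
have [x Cx] := choice x_ex.
have [||z Cz] := radon (C := fun i => C (enum_val i)) (x := x) Kd.
- by move=> i; exact: cC.
- move=> i j ij; apply: Cx; first exact: enum_valP.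
  by rewrite (inj_eq enum_val_inj).
exists z => j /= jK.
by have := Cz (enum_rank_in jK j); rewrite enum_rankK_in.
Qed.

End Helly.

(** * Convex hulls *)

Section Hull.
Variables (R : realType) (V : lmodType R).

(** With this encoding, one half-space containing [X] but not [x] excludes [x]. *)
Definition hull (X : set V) : set V :=
  [set x | forall C : set V, convex_set C -> X `<=` C -> C x].

Lemma sub_hull (X : set V) : X `<=` hull X.
Proof. by move=> x Xx C _; apply. Qed.

Lemma convex_hull (X : set V) : convex_set (hull X).
Proof.
apply/convex_setP => x y t t01 Xx Xy C cC XC.
by move/convex_setP: (cC); apply=> //; [exact: Xx | exact: Xy].
Qed.

End Hull.

(** * Greedy hitting sets *)

Section Hitting.
Variables (R : realType) (I : finType).
Implicit Types (b : R) (K : {set {set I}}).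

Definition hittable b (k m : nat) := forall K, (#|K| <= m)%N ->
  (forall A, A \in K -> #|~: A|%:R < b * #|I|%:R) ->
  exists2 J : {set I}, (#|J| <= k)%N & forall A, A \in K -> A :&: J != finset.set0.

Lemma hittable0 b : hittable b 0 0.
Proof.
move=> K; rewrite leqn0 cards_eq0 => /eqP -> _.
by exists finset.set0; rewrite ?cards0// => A; rewrite inE.
Qed.

Lemma le_hittable b b' k m : b <= b' -> hittable b' k m -> hittable b k m.
Proof.
move=> bb' hK K Km Kb; apply: hK => // A /Kb Ab.
by apply: lt_le_trans Ab _; rewrite ler_wpM2r.
Qed.

Lemma hittable_mono b k k' m m' : (k <= k')%N -> (m' <= m)%N ->
  hittable b k m -> hittable b k' m'.
Proof.
move=> kk' mm' hK K Km Kb; have [|J Jk JK] := hK K _ Kb.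
  exact: leq_trans mm'.
by exists J => //; exact: leq_trans kk'.
Qed.

(* Double counting of the pairs (i, A) with [i \notin A]. *)
Lemma popular_element b K : K != finset.set0 ->
    (forall A, A \in K -> #|~: A|%:R < b * #|I|%:R) ->
  exists i, #|[set A in K | i \notin A]|%:R < b * #|K|%:R.
Proof.
move=> K0 Kb; apply: contrapT => /forallNP nK.
have : (\sum_(A in K) #|~: A|%:R : R) < \sum_(A in K) b * #|I|%:R.
  have /set0Pn[A AK] := K0.
  rewrite (bigD1 A)//= [ltRHS](bigD1 A)//= ltr_leD ?Kb//.
  by apply: ler_sum => B /andP[BK _]; rewrite ltW ?Kb.
apply/negP; rewrite -leNgt.
have -> : \sum_(A in K) b * #|I|%:R = \sum_(i : I) b * #|K|%:R.
  by rewrite !sumr_const -[LHS]mulr_natr -[RHS]mulr_natr mulrAC.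
have -> : \sum_(A in K) #|~: A|%:R = \sum_(i : I) #|[set A in K | i \notin A]|%:R :> R.
  rewrite -!natr_sum; congr _%:R.
  under eq_bigr do rewrite -sum1_card.
  under [RHS]eq_bigr do rewrite -sum1_card.
  rewrite (exchange_big_dep predT)//=; apply: eq_bigr => i _.
  by apply: eq_bigl => A; rewrite !inE andbC.
apply: ler_sum => i _.
by rewrite leNgt; exact/negP/nK.
Qed.

(* An element of [popular_element] leaves fewer than [b * M <= m.+1] sets. *)
Lemma hittableS b k m M : 0 <= b -> b * M%:R <= m.+1%:R ->
  hittable b k m -> hittable b k.+1 M.
Proof.
move=> b0 bM hK K KM Kb; have [->|K0] := eqVneq K finset.set0.
  by exists finset.set0; rewrite ?cards0// => A; rewrite inE.
have [i Ki] := popular_element K0 Kb.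
have [||J Jk JK] := hK [set A in K | i \notin A].
- rewrite -ltnS -(ltr_nat R); apply: lt_le_trans Ki _; apply: le_trans bM.
  by rewrite ler_wpM2l// ler_nat.
- by move=> A; rewrite inE => /andP[/Kb].
exists (i |: J)%SET.
  by rewrite cardsU1 -add1n leq_add// leq_b1.
move=> A AK; apply/set0Pn; have [iA|iA] := boolP (i \in A).
  by exists i; rewrite !inE iA eqxx.
have /set0Pn[j] : A :&: J != finset.set0 by apply: JK; rewrite inE AK.
by rewrite inE => /andP[jA jJ]; exists j; rewrite !inE jA jJ orbT.
Qed.

(** One index per set suffices: as [b <= 1], each chosen index hits at least one remaining set. *)
Lemma hittable_diag b k : 0 <= b <= 1 -> hittable b k k.
Proof.
move=> /andP[b0 b1]; elim: k => [|k IHk]; first exact: hittable0.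
by apply: hittableS IHk => //; rewrite ler_piMl.
Qed.

(** Each index shrinks the number of unhit sets by a factor [b], so after [k.+1] of them fewer than
    1 remains. *)
Lemma hittable_exp b k M : 0 <= b -> b ^+ k.+1 * M%:R <= 1 -> hittable b k.+1 M.
Proof.
move=> b0; elim: k M => [|k IHk] M bM.
  by apply: (hittableS b0 _ (@hittable0 b)); rewrite -[b]expr1.
have bM0 : 0 <= b * M%:R by rewrite mulr_ge0.
have /andP[tM Mt] := truncn_itv bM0.
apply: (hittableS (m := Num.truncn (b * M%:R))) => //; first exact: ltW.
apply: IHk; apply: le_trans bM; rewrite [in leRHS]exprSr -mulrA.
by rewrite ler_wpM2l// exprn_ge0.
Qed.

End Hitting.

(** * From hitting sets to a deep point *)

Section Transversal.
Variable R : realType.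

Lemma deep_point (d k : nat) (I : finType) (F : I -> set 'rV[R]_d) (b : R) :
    (2 <= k)%N -> (forall i, convex_set (F i)) -> k_intersecting k F ->
    hittable I b k d.+1 ->
  exists p : 'rV[R]_d, forall H : set 'rV[R]_d,
    hyperplane H -> H p -> b * #|I|%:R <= (num_transversal H F)%:R.
Proof.
move=> k2 cF kF hb.
pose U (A : {set I}) := \bigcup_(i in [set` A]) F i.
(* If a hyperplane through [p] meets fewer than [b * #|I|] members, the members
   it misses form a large index set; pairwise intersection puts them all on one
   side, so that [p] is not in the hull of their union. *)
pose large := [set A : {set I} | (#|~: A|%:R < b * #|I|%:R)]%SET.
have [||p pU] := helly (C := fun A => hull (U A)) (K := large).
- by move=> A; exact: convex_hull.
- move=> K Kl Kd; have [|J Jk JK] := hb K Kd.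
    by move=> A /(fintype.subsetP Kl); rewrite inE.
  have [x Jx] := kF J Jk; exists x => A /= AK; apply: sub_hull.
  have /set0Pn[i] := JK A AK; rewrite inE => /andP[iA iJ].
  by exists i => //; exact: Jx.
exists p => H [a a0 [c HE]] Hp; rewrite leNgt; apply/negP => Hb.
pose f (x : 'rV[R]_d) := (x *m a) ord0 ord0.
have fD t x y : f (t *: x + (1 - t) *: y) = t * f x + (1 - t) * f y.
  by rewrite /f mulmxDl -!scalemxAl !mxE.
pose A := [set i | ~~ `[< Defs.transversal H (F i) >]]%SET.
have pA : hull (U A) p.
  apply: pU; rewrite /= inE; apply: le_lt_trans Hb; rewrite ler_nat.
  apply: subset_leq_card; apply/fintype.subsetP => i.
  by rewrite finset.in_setC inE negbK.
have avoid i x : i \in A -> F i x -> f x != c.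
  rewrite inE => /asboolPn nH Fx; apply/negP => /eqP fx.
  by apply: nH; exists x; split; rewrite ?HE.
have meet i j : exists x, F i x /\ F j x.
  have [|x ijx] := kF [set i; j]%SET.
    by apply: leq_trans k2; rewrite cards2; case: (_ != _).
  by exists x; split; apply: ijx; rewrite /= !inE eqxx ?orbT.
(* Otherwise the segment from [x] to [y] crosses [H] inside [F i]; [t] solves
   [t * f x + (1 - t) * f y = c]. *)
have same_side i x y : i \in A -> F i x -> F i y -> f x < c -> f y < c.
  move=> iA Fx Fy fx; rewrite ltNge; apply/negP => fy.
  have xy : 0 < f y - f x by rewrite subr_gt0 (lt_le_trans fx).
  pose t := (f y - c) / (f y - f x).
  have t01 : 0 <= t <= 1.
    rewrite divr_ge0 ?subr_ge0// ?(ltW (lt_le_trans fx fy))//=.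
    by rewrite ler_pdivrMr// mul1r lerB// ltW.
  have /convex_setP/(_ x y t t01 Fx Fy) Fz := cF i.
  have := avoid _ _ iA Fz; rewrite fD => /eqP; apply.
  by rewrite /t; field; rewrite gt_eqF.
have fp : f p = c by move: Hp; rewrite HE.
(* The sign [s], later 1 or -1, covers both open sides of [H]. *)
have halfspace (s : R) : convex_set [set x : 'rV[R]_d | s * f x < s * c].
  apply/convex_setP => x y t /andP[t0 t1] /= fx fy; rewrite fD.
  have [->|tn0] := eqVneq t 0; first by rewrite mul0r add0r subr0 mul1r.
  have tp : 0 < t by rewrite lt_neqAle eq_sym tn0.
  have : t * (s * f x) < t * (s * c) by rewrite ltr_pM2l.
  have : (1 - t) * (s * f y) <= (1 - t) * (s * c).
    by rewrite ler_wpM2l ?subr_ge0// ltW.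
  lra.
have [[i [iA [x [Fx fx]]]]|nneg] :=
    pselect (exists i, i \in A /\ exists x, F i x /\ f x < c).
  have /= := pA _ (halfspace 1); rewrite fp ltxx => H1; apply/notF/H1.
  move=> y [j jA Fy] /=; rewrite !mul1r.
  have [z [iz jz]] := meet i j.
  by apply: (same_side j z) => //; exact: (same_side i x).
have /= := pA _ (halfspace (-1)); rewrite fp ltxx => H1; apply/notF/H1.
move=> y [j jA Fy] /=; rewrite !mulN1r ltrN2 lt_neqAle eq_sym (avoid j)//=.
rewrite leNgt; apply/negP => fy; apply: nneg.
by exists j; split => //; exists y.
Qed.

End Transversal.

(** * Estimates for [b = d / (d + 5)] *)

Section Greedy.
Variables (R : realType) (I : finType).

(* [(1 + 5 / d) ^ d <= exp 5 <= 225]. *)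
Lemma root225_le (d : nat) : (0 < d)%N ->
  1 / 225 `^ d%:R^-1 <= d%:R / (d + 5)%:R :> R.
Proof.
move=> d0; have dR : 0 < d%:R :> R by rewrite ltr0n.
(* Inverts [exp (- 1/7) >= 1 - 1/7]; seventh and then fifth powers bound [exp 5]. *)
have e17 : expR 7^-1 <= 7 / 6 :> R.
  rewrite -[expR _]invrK -expRN -[leRHS]invrK lef_pV2 ?posrE ?expR_gt0 ?invr_gt0//.
  by apply: le_trans (expR_ge1Dx _); lra.
have e1 : expR 1 <= 59 / 20 :> R.
  have -> : 1 = 7%:R * 7^-1 :> R by rewrite divff.
  rewrite expRM_natl; apply: le_trans (_ : (7 / 6) ^+ 7 <= _); last by lra.
  by rewrite lerXn2r ?nnegrE ?expR_ge0.
have e5 : expR 5 <= 225 :> R.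
  rewrite -[5]mulr1 expRM_natl; apply: le_trans (_ : (59 / 20) ^+ 5 <= _).
    by rewrite lerXn2r ?nnegrE ?expR_ge0.
  by lra.
have r0 : 0 < 225 `^ d%:R^-1 :> R by rewrite powR_gt0.
rewrite ler_pdivrMr// mulrAC ler_pdivlMr ?ltr0n ?addn_gt0 ?orbT// mul1r.
rewrite natrD -ler_pdivrMl// mulrDr mulVf ?gt_eqF//.
apply: le_trans (expR_ge1Dx _) _.
rewrite mulrC expRM.
by apply: ge0_ler_powR => //; rewrite ?invr_ge0 ?nnegrE ?expR_ge0.
Qed.

(** While more than [m] sets remain, an index misses a fraction below [d / (d + 5)] of them; the
    condition on [t] makes each of the [s] new indices account for [t.+1] sets. *)
Lemma hittable_greedy d t s k m : (d * t <= 5 * m.+1)%N ->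
  hittable I (d%:R / (d + 5)%:R : R) k m ->
  hittable I (d%:R / (d + 5)%:R : R) (s + k) (m + s * t.+1).
Proof.
move=> dt hk; elim: s => [|s IHs]; first by rewrite addn0.
apply: hittableS IHs; first by rewrite divr_ge0.
rewrite mulrAC ler_pdivrMr ?ltr0n ?addn_gt0 ?orbT// -!natrM ler_nat.
by nia.
Qed.

(** The iterated map is the worst-case greedy count: fewer than [d * m / (d + 5)] sets means at most
    [(d * m).-1 %/ (d + 5)]. *)
Lemma hittable_iter d s : iter s (fun m => (d * m).-1 %/ (d + 5))%N d.+1 = 0%N ->
  hittable I (d%:R / (d + 5)%:R : R) s d.+1.
Proof.
elim: s d.+1 => [|s IHs] M; first by move=> /= ->; exact: hittable0.
rewrite iterSr => /IHs; apply: hittableS; first by rewrite divr_ge0.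
rewrite mulrAC ler_pdivrMr ?ltr0n ?addn_gt0 ?orbT// -!natrM ler_nat.
apply: leq_trans (leqSpred _) (ltn_ceil _ _).
by rewrite addn_gt0 orbT.
Qed.

Lemma hittable_uphalf d : (3 <= d)%N ->
  hittable I (d%:R / (d + 5)%:R : R) (uphalf d) d.+1.
Proof.
move=> d3; have [d100|d100] := ltnP d 100.
  (* Below 100, rounding is too coarse for the staged estimate, so the greedy counts are
     computed. *)
  apply: hittable_iter; apply/eqP; move: d d100 d3.
  have : all (fun d => iter (uphalf d) (fun m => (d * m).-1 %/ (d + 5))%N d.+1 == 0%N)
      (iota 3 97) by vm_compute.
  by move=> /allP h d d100 d3; apply: h; rewrite mem_iota d3.
(* Greedy stages in which each new element hits at least 1, 2, 3, 4 sets, for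
   about d/5, d/10, d/15, d/10 steps: 7d/15 < d/2 in total. *)
have h1 : hittable I (d%:R / (d + 5)%:R : R) (d %/ 5) (d %/ 5).
  apply: hittable_diag; rewrite divr_ge0//=.
  by rewrite ler_pdivrMr ?ltr0n ?addn_gt0 ?orbT// mul1r ler_nat leq_addr.
have h2 := hittable_greedy (t := 1) (s := (d + 9) %/ 10) _ h1.
have h3 := hittable_greedy (t := 2) (s := (d + 14) %/ 15) _ (h2 _).
have h4 := hittable_greedy (t := 3) (s := (d + 14) %/ 10) _ (h3 _ _).
by apply: hittable_mono (h4 _ _ _); rewrite ?uphalfE; lia.
Qed.

End Greedy.

Theorem theorem8 (R : realType) :
  [/\ forall k : nat, (2 <= k)%N ->
        exists2 c : R, 0 < c &
          forall (d : nat) (I : finType) (F : I -> set 'rV[R]_d),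
            (forall i, convex_set (F i)) -> k_intersecting k F ->
            exists p : 'rV[R]_d, forall H : set 'rV[R]_d,
              hyperplane H -> H p ->
              c * (#|I|%:R / d.+1%:R `^ k%:R^-1) <= (num_transversal H F)%:R,
      forall (d : nat) (I : finType) (F : I -> set 'rV[R]_d),
        (2 <= d)%N ->
        (forall i, convex_set (F i)) -> k_intersecting d F ->
        exists p : 'rV[R]_d, forall H : set 'rV[R]_d,
          hyperplane H -> H p ->
          d%:R / d.+1%:R * #|I|%:R <= (num_transversal H F)%:R :> R
    & forall (d : nat) (I : finType) (F : I -> set 'rV[R]_d),
        (2 <= uphalf d)%N ->
        (forall i, convex_set (F i)) -> k_intersecting (uphalf d) F ->
        exists p : 'rV[R]_d, forall H : set 'rV[R]_d,
          hyperplane H -> H p ->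
          1 / 225 `^ d%:R^-1 * #|I|%:R <= (num_transversal H F)%:R :> R].
Proof.
split.
- move=> k k2; exists 1 => // d I F cF kF.
  have [|p Hp] := deep_point (b := (d.+1%:R `^ k%:R^-1)^-1) k2 cF kF; last first.
    by exists p => H hH Hp'; rewrite mul1r mulrC; exact: Hp.
  case: k k2 {kF} => // k k2; apply: hittable_exp; first by rewrite invr_ge0 powR_ge0.
  rewrite exprVn -powR_mulrn ?powR_ge0// -powRrM mulVf ?pnatr_eq0// powRr1//.
  by rewrite mulVf ?pnatr_eq0.
- move=> d I F d2 cF kF; apply: (deep_point d2) => //.
  case: d d2 {F cF kF} => // d _.
  (* The dimension is now [d.+1]. The first index leaves fewer than [d.+1] of the [d.+2] sets; the
     other [d] indices take one set each. *)
  apply: (hittableS (m := d)); rewrite ?divr_ge0 ?divfK ?pnatr_eq0//.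
  apply: hittable_diag; rewrite divr_ge0//=.
  by rewrite ler_pdivrMr// mul1r ler_nat.
- move=> d I F d2 cF kF; apply: (deep_point d2) => //.
  have d3 : (3 <= d)%N by rewrite uphalfE in d2; lia.
  apply: (le_hittable _ (hittable_uphalf d3)).
  by apply: root225_le; lia.
Qed.
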